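(* Let $p\ge 3$ be a prime, let $N$ be a positive integer coprime to $p$, and let $\alpha\ge 0$ be an integer. (1) If $p\equiv 1\pmod 7$, then $\overline{p}_3(7p^{14\alpha+13}N)\equiv 0\pmod 7$. (2) If $p\equiv 2,3,4,5,6\pmod 7$, then $\overline{p}_3(7p^{12\alpha+11}N)\equiv 0\pmod 7$. (3) If $p\equiv 6\pmod 7$, then $\overline{p}_3(7p^{3}N)\equiv 0\pmod 7$.
   Context: An overpartition of $n$ is a partition of $n$ in which the first occurrence of each distinct part may (or may not) be overlined. An overpartition triple of $n$ is a triple of overpartitions whose parts together sum to $n$. $\overline{p}_3(n)$ denotes the number of overpartition triples of $n$, with $\overline{p}_3(0)=1$; equivalently $\sum_{n\ge0}\overline{p}_3(n)q^n=\big((-q;q)_\infty/(q;q)_\infty\big)^3$, where $(a;q)_\infty=\prod_{n\ge0}(1-aq^n)$. *)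

(* Defs.v *)
From mathcomp Require Import all_boot.

Set Implicit Arguments.
Unset Strict Implicit.
Unset Printing Implicit Defensive.

(* An entry (k, b) is a part k, overlined iff b. Parts are listed in weakly
   decreasing order, so equal parts are adjacent, and the second disjunct says
   that a part preceded by an equal one is not overlined: only the first
   occurrence of each distinct part may be. *)
Definition entry_rel : rel (nat * bool) :=
  fun x y => (y.1 < x.1) || (y.1 == x.1) && ~~ y.2.

Definition is_overpartition (s : seq (nat * bool)) : bool :=
  sorted entry_rel s && all (fun x => 0 < x.1) s.

Definition weight (s : seq (nat * bool)) : nat := \sum_(x <- s) x.1.

Definition is_overpartition_triple (n : nat)
    (t : seq (nat * bool) * seq (nat * bool) * seq (nat * bool)) : bool :=
  let: (s1, s2, s3) := t in
  [&& is_overpartition s1, is_overpartition s2, is_overpartition s3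
    & weight s1 + weight s2 + weight s3 == n].

(* Lists of at most n entries with parts at most n: a finite type in which
   every overpartition of weight at most n has exactly one code (decode_inj and
   decode_onto), so that the triples of n can be counted with #|_|. *)
Definition code (n : nat) : finType := {bseq n of 'I_n.+1 * bool}.

Definition decode (n : nat) (c : code n) : seq (nat * bool) :=
  [seq (nat_of_ord x.1, x.2) | x <- (c : {bseq n of 'I_n.+1 * bool})].

Definition pbar3 (n : nat) : nat :=
  #|[set c : code n * code n * code n |
      is_overpartition_triple n (decode c.1.1, decode c.1.2, decode c.2)]|.

Lemma decode_inj (n : nat) : injective (@decode n).
Proof.
move=> c d; rewrite /decode => eq_cd; apply: val_inj => /=.
apply: (inj_map _ eq_cd) => -[i b] [j e] [/val_inj -> ->] //.
Qed.

Lemma decode_onto (n : nat) (s : seq (nat * bool)) :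
  is_overpartition s -> weight s <= n -> exists c : code n, decode c = s.
Proof.
rewrite /is_overpartition /weight => /andP[_ /allP s_pos] le_sn.
have size_s : size s <= n.
  apply: leq_trans le_sn; rewrite -sum1_size big_seq [X in _ <= X]big_seq.
  exact: leq_sum.
pose u := [seq (inord x.1 : 'I_n.+1, x.2) | x <- s].
have size_u : size u <= n by rewrite size_map.
exists (Bseq size_u : code n); rewrite /decode /= /u -map_comp.
rewrite -[RHS]map_id; apply/eq_in_map => -[k b] s_kb /=; rewrite inordK //.
rewrite ltnS; apply: leq_trans le_sn.
by rewrite (big_rem (k, b)) //= leq_addr.
Qed.

(* Main.v *)
(* Write theta = sum_j (-X)^(j^2). Gauss's identity says that the series of
   overpartitions is 1/theta; it follows from Shanks's finite version, whose
   inductive step telescopes. Modulo 7, 1/theta^3 = theta^4 / theta(X^7), so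
   extracting the exponents divisible by 7 and using r4(7n) = r4(n) mod 7 yields
   pbar3(7n) = (-1)^n r3(n) mod 7, where rk(n) counts the representations of n
   as a sum of k squares.

   The congruence for r4 is a double count: a quaternion x with 7 | N(x) is a
   left multiple of 1 (mod 7) of the eight quaternions 2 +- i +- j +- k.

   For an odd prime p dividing n, (p + 1) r3(n) = r3(p^2 n) + p r3(n / p^2). Each
   nonzero isotropic vector x of F_p^3 has, by Lagrange's descent, an integer
   quaternion y of norm p with p | x y, and v |-> y v conj(y) identifies the pure
   quaternions of norm n with those pure w of norm p^2 n for which p^2 divides
   conj(y) w y. Counting the pairs (x, w) by w gives the relation. Hence
   r3(p^(2k+1) N) = (1 + p + ... + p^k) r3(p N), and 7 divides the sum of powers
   in each of the three cases. *)
Require Import Defs.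
From HB Require Import structures.
From mathcomp Require Import all_boot all_order all_algebra.
From mathcomp Require Import ring lra zify.

Set Implicit Arguments.
Unset Strict Implicit.
Unset Printing Implicit Defensive.

Import Order.TTheory GRing.Theory Num.Theory.

(** * Counting overpartitions *)

(* The lists s of weight n such that (m, b) :: s is an overpartition do not depend
   on b; they are enumerated by [tails k m n] for any fuel k >= n. *)
Definition next_entries (m n : nat) : seq (nat * bool) :=
  [seq y <- [seq (i, b) | i <- iota 1 n, b <- [:: true; false]]
     | entry_rel (m, true) y].

Fixpoint tails (k m n : nat) : seq (seq (nat * bool)) :=
  if n == 0 then [:: [::]] else
  if k is k'.+1 then
    flatten [seq [seq y :: s | s <- tails k' y.1 (n - y.1)]
               | y <- next_entries m n]
  else [::].

Lemma mem_next_entries m n y :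
  (y \in next_entries m n) = [&& entry_rel (m, true) y, 0 < y.1 & y.1 <= n].
Proof.
rewrite mem_filter; congr (_ && _); case: y => i b.
have -> : (0 < (i, b).1) && ((i, b).1 <= n) = (i \in iota 1 n).
  by rewrite mem_iota add1n ltnS.
apply/allpairsPdep/idP => [[j [c [? ? [-> _]]]] //| i_in].
by exists i, b; split => //; case: b.
Qed.

(** The flag [b] is arbitrary because [entry_rel] ignores the overlining of its first argument; so
    the recursion only has to remember [y.1]. *)
Lemma mem_tails k m b n s : n <= k ->
  (s \in tails k m n) =
  [&& path entry_rel (m, b) s, all (fun x => 0 < x.1) s & weight s == n].
Proof.
elim: k m b n s => [|k IH] m b n s /=.
  rewrite leqn0 => /eqP->; rewrite inE; case: s => [|[[|i] c] s] /=.
  - by rewrite /weight big_nil.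
  - by rewrite andbF.
  - by rewrite /weight big_cons /= addSn !andbF.
case: eqP => [->|n0] le_nk.
  rewrite inE; case: s => [|[[|i] c] s] /=.
  - by rewrite /weight big_nil.
  - by rewrite andbF.
  - by rewrite /weight big_cons /= addSn !andbF.
have le_subk i : 0 < i -> n - i <= k by lia.
case: s => [|y s].
  rewrite /weight big_nil /= eq_sym; move/eqP/negbTE: n0 => ->.
  by apply/flatten_mapP => -[y _ /mapP[]].
have -> : path entry_rel (m, b) (y :: s) =
  entry_rel (m, true) y && path entry_rel y s by [].
rewrite /weight big_cons /= -/(weight s).
apply/flatten_mapP/idP => [[z] | /and3P[/andP[y_rel y_path] /andP[y0 s0] /eqP w]].
  rewrite mem_next_entries => /and3P[z_rel z0 zn] /mapP[u u_in [-> ->]].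
  move: u_in; rewrite (IH _ z.2) -?surjective_pairing; last exact: le_subk z0.
  by case/and3P=> -> -> /eqP ->; rewrite z_rel z0 subnKC // eqxx.
exists y; first by rewrite mem_next_entries y_rel y0 -w leq_addr.
rewrite map_f // (IH _ y.2) -?surjective_pairing; last exact: le_subk y0.
by rewrite y_path s0 -w addKn eqxx.
Qed.

Lemma tails_uniq k m n : uniq (tails k m n).
Proof.
elim: k m n => [|k IH] m n /=; case: eqP => // _.
apply: allpairs_uniq_dep => [|y _|[y s] [z t] _ _ /= [-> ->]] //.
by rewrite filter_uniq // allpairs_uniq ?iota_uniq // => -[i b] [j c] _ _ [-> ->].
Qed.

Definition ntails m n := size (tails n m n).

Lemma size_tails k m n : n <= k -> size (tails k m n) = ntails m n.
Proof.
move=> le_nk; apply/eqP; rewrite -uniq_size_uniq ?tails_uniq // => s.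
by rewrite !(mem_tails _ true).
Qed.

(** A next part smaller than [m] comes with or without an overline, hence the factor 2; a repetition
    of [m] must be plain. *)
Lemma ntailsE m n : 0 < n ->
  ntails m n =
  \sum_(1 <= i < n.+1 | i <= m) (if i < m then 2 else 1) * ntails i (n - i).
Proof.
case: n => // n _; rewrite {1}/ntails [tails _ _ _]/=.
rewrite size_flatten /shape -map_comp sumnE big_map /next_entries big_filter.
rewrite big_mkcond big_allpairs_dep /index_iota subSS subn0 [RHS]big_mkcond.
rewrite big_seq [RHS]big_seq; apply: eq_bigr => i; rewrite mem_iota add1n => /andP[i0 _].
rewrite !big_cons big_nil /entry_rel /= !size_map !size_tails; try lia.
by case: ltngtP => //= _; lia.
Qed.

Lemma ntailsSE m n :
  ntails m.+1 n = (n == 0) + (if m < n then ntails m.+1 (n - m.+1) else 0)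
    + 2 * \sum_(1 <= i < m.+1) (if i <= n then ntails i (n - i) else 0).
Proof.
have [->|n0] := posnP n.
  rewrite big_nat_cond big1 // => -[|i] //= /andP[]; by rewrite ltn0.
rewrite ntailsE // (big_nat_widen _ _ (n + m.+2)) ?addnS ?ltnS ?leqW ?leq_addr //.
rewrite (eq_bigl (fun i => (i <= n) && (i < m.+2))); last first.
  by move=> i; rewrite andbC.
rewrite -(big_nat_widen 1 m.+2) ?ltnS ?leq_addl // big_mkcond big_nat_recr //=.
rewrite ltnn mul1n add0n addnC; congr (_ + _).
rewrite big_distrr /= !big_nat; apply: eq_bigr => i /andP[_ ->].
by case: ifP; rewrite ?muln0.
Qed.

(** Difference of [ntailsSE] at two consecutive values of [m]: the sums cancel except for their last
    term. For generating functions this reads (1 - X^(m+1)) T_(m+1) = (1 + X^m) T_m. *)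
Lemma ntails_rec m n : 0 < m ->
  ntails m.+1 n = ntails m n + (if m <= n then ntails m (n - m) else 0)
  + (if m < n then ntails m.+1 (n - m.+1) else 0).
Proof.
by case: m => // m _; rewrite (ntailsSE m.+1 n) (ntailsSE m n) big_nat_recr //=; lia.
Qed.

(** The fictitious preceding part [n.+1] exceeds every part and so imposes no constraint: all
    overpartitions of [n] are counted. *)
Definition nover n := ntails n.+1 n.

Lemma ntails_stable m n : n < m -> ntails m n = nover n.
Proof.
move=> lt_nm; rewrite -(subnK lt_nm); elim: (m - n.+1) => // k IH.
by rewrite addSn ntails_rec ?IH ?addnS // !ifN ?addn0 -?leqNgt -?ltnNge //; lia.
Qed.

Lemma card_overpartitions n i : i <= n ->
  #|[set c : code n | is_overpartition (decode c) && (weight (decode c) == i)]|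
  = nover i.
Proof.
move=> le_in; rewrite cardE -(size_map (@decode n)).
apply: perm_size; apply: uniq_perm; rewrite ?tails_uniq //.
  by rewrite map_inj_uniq ?enum_uniq //; apply: decode_inj.
move=> s; rewrite (mem_tails _ true) //.
have -> : path entry_rel (i.+1, true) s && (all (fun x => 0 < x.1) s && (weight s == i))
  = is_overpartition s && (weight s == i).
  rewrite /is_overpartition !andbA; apply: andb_id2r => /eqP w.
  congr (_ && _); case: s w => //= y s; rewrite /weight big_cons => w.
  by rewrite {1}/entry_rel /= ltnS -w leq_addr.
apply/mapP/idP => [[c] | /andP[s_op /eqP w]].
  by rewrite mem_enum inE => ? ->.
have [c dc] : exists c : code n, decode c = s by apply: decode_onto; rewrite ?w.
by exists c => //; rewrite mem_enum inE dc s_op w eqxx.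
Qed.

Local Open Scope ring_scope.

(** * Theta series *)

Fixpoint zrange (K : nat) : seq int :=
  if K is K'.+1 then K%:Z :: - K%:Z :: zrange K' else [:: 0].

Lemma mem_zrange K z : (z \in zrange K) = (`|z| <= K)%N.
Proof.
by elim: K => [|K IH] /=; rewrite !inE ?IH; lia.
Qed.

Lemma zrange_uniq K : uniq (zrange K).
Proof. by elim: K => //= K ->; rewrite !inE !mem_zrange; lia. Qed.

Section Shanks.
Variable R : comNzRingType.
Implicit Types (P Q : {poly R}) (n s : nat).

Definition theta K : {poly R} :=
  \sum_(j <- zrange K) (- 'X) ^+ (`|j| ^ 2).

Lemma thetaS K : theta K.+1 = theta K + 2 * (-1) ^+ K.+1 * 'X^(K.+1 ^ 2).
Proof.
rewrite /theta /= !big_cons abszN absz_nat (exprNn (polyX R)).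
by rewrite -(signr_odd _ (_ ^ 2)) oddX signr_odd; ring.
Qed.

(** For s <= n this is the quotient (X; X)_n / (X; X)_s, written without division. *)
Definition prodD s n : {poly R} := \prod_(s <= i < n) (1 - 'X^(i.+1)).
Definition prodE n : {poly R} := \prod_(0 <= i < n) (1 + 'X^(i.+1)).
(* shanks_coef s / prodD 0 s is the series of overpartitions of largest part s. *)
Definition shanks_coef s : {poly R} :=
  if s is s'.+1 then 2 * 'X^s * prodE s' else 1.

Lemma prodDS s n : (s <= n)%N -> prodD s n.+1 = prodD s n * (1 - 'X^(n.+1)).
Proof. by move=> le_sn; rewrite /prodD big_nat_recr. Qed.

Lemma prodES n : prodE n.+1 = prodE n * (1 + 'X^(n.+1)).
Proof. by rewrite /prodE big_nat_recr. Qed.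

Lemma prodD_ltn s n : (s < n)%N -> prodD s n = (1 - 'X^(s.+1)) * prodD s.+1 n.
Proof. by move=> lt_sn; rewrite /prodD big_ltn. Qed.

(** The term s = 0 is [prodD 0 n] and all others are divisible by X^(n+1), so Gauss's identity is
    the limit of this one. *)
Lemma shanks n :
  prodE n * theta n =
  \sum_(0 <= s < n.+1) (-1) ^+ s * shanks_coef s * 'X^(s * n) * prodD s n.
Proof.
elim: n => [|n IH].
  rewrite big_nat1 /theta /= big_seq1 /prodE /prodD !big_geq //=.
  by rewrite !mul0n !expr0 !mulr1.
(* Telescoping certificate: from [n] to [n.+1] each summand is multiplied by 1 + X^(n+1) and then
   increased by [V s.+1 - V s]. The end value [V n.+1] and the new summand add up to [prodE n.+1]
   times the new terms of theta. *)
pose V s : {poly R} := if s is s'.+1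
  then (-1) ^+ s * 2 * prodE s' * 'X^(s * n.+1) * prodD s' n else 0.
have term s : (0 <= s < n.+1)%N ->
  (-1) ^+ s * shanks_coef s * 'X^(s * n.+1) * prodD s n.+1
  = (1 + 'X^(n.+1)) * ((-1) ^+ s * shanks_coef s * 'X^(s * n) * prodD s n)
    + (V s.+1 - V s).
  move=> /= lt_sn; rewrite prodDS // /V !mulnS !mulSn !exprD; case: s lt_sn => [|s] lt_sn.
    rewrite /= !mul0n !expr0 /prodE big_geq //.
    set x := 'X^(n.+1); rewrite /x exprS; ring.
  rewrite [prodD s n]prodD_ltn // prodES /= !mulSn !exprD.
  rewrite [(-1)^+s.+2]exprS; set e := (-1) ^+ _; rewrite !exprS; ring.
rewrite big_nat_recr //= (eq_big_nat _ _ term) big_split /= -mulr_sumr -IH.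
rewrite telescope_sumr // /V subr0 prodES thetaS /prodD !big_geq //.
rewrite -mulnn !exprS !exprD; ring.
Qed.
End Shanks.

(** * Power series as polynomials modulo X^K, and Gauss's identity *)

Section Series.
Variable R : comNzRingType.
Implicit Types (p q r : {poly R}).

Definition eqX K p q := forall i, (i < K)%N -> p`_i = q`_i.

Lemma eqX_trans K q p r : eqX K p q -> eqX K q r -> eqX K p r.
Proof. by move=> e f i lt_iK; rewrite e ?f. Qed.

Lemma eqXM K p q p' q' : eqX K p q -> eqX K p' q' -> eqX K (p * p') (q * q').
Proof.
move=> e f i lt_iK; rewrite !coefM; apply: eq_bigr => -[j /= lt_j] _.
by rewrite e ?f //; lia.
Qed.

Lemma eqXMl K r p q : eqX K p q -> eqX K (r * p) (r * q).
Proof. exact: eqXM. Qed.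

Lemma eqX_expr K p q n : eqX K p q -> eqX K (p ^+ n) (q ^+ n).
Proof. by move=> e; elim: n => // n IH; rewrite !exprS; apply: eqXM. Qed.

(** A polynomial with constant coefficient 1 is invertible modulo X^K; the coefficients are compared
    by strong induction. *)
Lemma eqX_cancel K r p q :
  r`_0 = 1 -> eqX K (r * p) (r * q) -> eqX K p q.
Proof.
move=> r0 e i; elim/ltn_ind: i => i IH lt_iK; have := e i lt_iK.
rewrite !coefM !big_ord_recl /= subn0 r0 !mul1r.
rewrite (eq_bigr (fun j : 'I_i => r`_(lift ord0 j) * q`_(i - lift ord0 j))).
  by move/addIr.
by move=> [j /= lt_ji] _; rewrite IH // /bump; lia.
Qed.

Lemma eqX_Xn K n p : (K <= n)%N -> eqX K ('X^n * p) 0.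
Proof. by move=> le_Kn i lt_iK; rewrite coefXnM coef0 (leq_trans lt_iK). Qed.

Definition tail_series K m : {poly R} := \poly_(n < K) (ntails m n)%:R.
Definition over_series K : {poly R} := \poly_(n < K) (nover n)%:R.

Lemma tail_series_rec K m : (0 < m)%N ->
  eqX K ((1 - 'X^(m.+1)) * tail_series K m.+1) ((1 + 'X^m) * tail_series K m).
Proof.
move=> m0 i lt_iK; rewrite mulrBl mulrDl !mul1r coefB coefD !coefXnM !coef_poly.
rewrite lt_iK ntails_rec // !natrD.
rewrite !(leq_ltn_trans (leq_subr _ _) lt_iK).
by case: (ltngtP i m) => h; do ?[case: ifP => ?]; try lia; ring.
Qed.

(** Iterates [tail_series_rec]. The base case is the geometric series (1 - X) T_1 = 1, since only
    plain parts 1 may follow a part 1. *)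
Lemma tail_series_prod K m :
  eqX K (prodD R 0 m.+1 * tail_series K m.+1) (prodE R m).
Proof.
elim: m => [|m IH].
  move=> i lt_iK; rewrite /prodD /prodE big_nat1 big_geq // mulrBl mul1r.
  rewrite coefB coefXnM !coef_poly lt_iK (leq_ltn_trans (leq_subr _ _) lt_iK).
  rewrite ntailsSE big_geq // muln0 addn0 natrD coef1.
  by case: i lt_iK => [|i] lt_iK /=; rewrite ?addr0 ?subr0 ?add0r ?subrr.
rewrite prodDS // prodES mulrAC -mulrA [tail_series _ _ * _]mulrC.
apply: eqX_trans (eqXMl _ (tail_series_rec (ltn0Sn m))) _.
rewrite mulrCA mulrC; exact: eqXM.
Qed.

(** Multiplication by [prodD 0 K.+1] turns the series of overpartitions into [prodE K]; then
    [shanks] applies, and only its term s = 0 survives modulo X^K. *)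
Lemma over_theta K : eqX K (over_series K * theta R K) 1.
Proof.
apply: (@eqX_cancel _ (prodD R 0 K.+1)).
  rewrite /prodD -horner_coef0 horner_prod big1 // => i _.
  by rewrite !hornerE expr0n subr0.
rewrite mulr1 mulrA.
have e : eqX K (over_series K) (tail_series K K.+1).
  by move=> i lt_iK; rewrite !coef_poly lt_iK ntails_stable // ltnW.
apply: eqX_trans (eqXM (eqXMl (prodD R 0 K.+1) e) (fun i _ => erefl)) _.
apply: eqX_trans (eqXM (@tail_series_prod K K) (fun i _ => erefl)) _.
rewrite shanks big_ltn // expr0 mul0n expr0 !mul1r prodDS // => i lt_iK.
rewrite mulrBr mulr1 coefD coefB [_ * 'X^_]mulrC (@eqX_Xn K.+1) ?coef0 ?subr0 //;
  last exact: ltnW.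
rewrite coef_sum big1_seq ?addr0 // => -[|s] /andP[_]; rewrite mem_index_iota //.
move=> _; have -> : (-1) ^+ s.+1 * shanks_coef R s.+1 * 'X^(s.+1 * K) *
    prodD R s.+1 K = 'X^(s.+1 + s.+1 * K) *
    ((-1) ^+ s.+1 * 2 * prodE R s * prodD R s.+1 K).
  by rewrite exprD /=; ring.
by rewrite (@eqX_Xn K) ?coef0 //; lia.
Qed.
End Series.

(** * Integer quaternions *)

Record quat := Quat {q_re : int; q_i : int; q_j : int; q_k : int}.

Definition quat_tuple q := (q_re q, q_i q, q_j q, q_k q).
Definition tuple_quat (t : int * int * int * int) :=
  let: (a, b, c, d) := t in Quat a b c d.
Lemma quat_tupleK : cancel quat_tuple tuple_quat.
Proof. by case. Qed.
HB.instance Definition _ := Choice.copy quat (can_type quat_tupleK).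

(** A natural number, as it serves as an exponent of X; the bracketing follows the construction of
    [box4] from two copies of [box2]. *)
Definition qnorm q : nat :=
  (`|q_re q| ^ 2 + `|q_i q| ^ 2 + (`|q_j q| ^ 2 + `|q_k q| ^ 2))%N.

Definition box2 K := [seq (a, b) | a <- zrange K, b <- zrange K].
Definition box3 K := [seq Quat 0 a v.1 v.2 | a <- zrange K, v <- box2 K].
Definition box4 K := [seq Quat u.1 u.2 v.1 v.2 | u <- box2 K, v <- box2 K].

Lemma box2_uniq K : uniq (box2 K).
Proof. by apply: allpairs_uniq => [||[a b] [c d] _ _]; rewrite ?zrange_uniq. Qed.

Lemma box3_uniq K : uniq (box3 K).
Proof.
apply: allpairs_uniq => [||[a [b c]] [a' [b' c']] _ _ /= [-> -> ->]] //.
- exact: zrange_uniq.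
- exact: box2_uniq.
Qed.

Lemma box4_uniq K : uniq (box4 K).
Proof.
apply: allpairs_uniq => [||[[a b] [c d]] [[a' b'] [c' d']] _ _ /= [-> -> -> ->]] //;
exact: box2_uniq.
Qed.

(** The sizes of these two lists are r4(n) and r3(n): vectors of Z^3 are taken to be the pure
    quaternions. *)
Definition sphere4 (n : nat) := [seq q <- box4 n | qnorm q == n].
Definition sphere3 (n : nat) := [seq q <- box3 n | qnorm q == n].

Lemma sqr_le_abs (a : int) K n : (`|a| ^ 2 <= n)%N -> (n <= K)%N -> a \in zrange K.
Proof. by rewrite mem_zrange; nia. Qed.

Lemma mem_sphere4 K n q : (n <= K)%N ->
  (q \in [seq q <- box4 K | qnorm q == n]) = (qnorm q == n).
Proof.
move=> le_nK; rewrite mem_filter; apply: andb_idr => /eqP.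
case: q => a b c d; rewrite /qnorm /= => nq.
apply/allpairsP; exists ((a, b), (c, d)); split=> //=; apply/allpairsP.
  by exists (a, b); split=> //=; apply: sqr_le_abs le_nK; rewrite -nq; lia.
by exists (c, d); split=> //=; apply: sqr_le_abs le_nK; rewrite -nq; lia.
Qed.

Lemma mem_sphere3 K n q : (n <= K)%N ->
  (q \in [seq q <- box3 K | qnorm q == n]) = (q_re q == 0) && (qnorm q == n).
Proof.
move=> le_nK; rewrite mem_filter andbC.
have [/eqP nq|] := boolP (qnorm q == n); last by rewrite !andbF.
rewrite !andbT; case: q nq => a b c d; rewrite /qnorm /= => nq.
apply/allpairsP/eqP => [[[x [y z]]] [_ _ [-> _ _ _]] //| a0].
exists (b, (c, d)); rewrite a0; split=> //=.
  by apply: sqr_le_abs le_nK; rewrite -nq; lia.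
apply/allpairsP.
by exists (c, d); split=> //=; apply: sqr_le_abs le_nK; rewrite -nq; lia.
Qed.

Lemma sphere3_uniq n : uniq (sphere3 n).
Proof. exact: filter_uniq (box3_uniq n). Qed.

Lemma sphere4_uniq n : uniq (sphere4 n).
Proof. exact: filter_uniq (box4_uniq n). Qed.

(** * Powers of theta as generating functions of sums of squares *)

Section ThetaPowers.
Variable R : comNzRingType.

Lemma theta2E K :
  theta R K ^+ 2 = \sum_(v <- box2 K) (- 'X) ^+ (`|v.1| ^ 2 + `|v.2| ^ 2).
Proof.
rewrite expr2 {1}/theta mulr_suml /box2 big_allpairs_dep; apply: eq_bigr => a _.
by rewrite mulr_sumr; apply: eq_bigr => b _; rewrite exprD.
Qed.

Lemma theta3E K : theta R K ^+ 3 = \sum_(q <- box3 K) (- 'X) ^+ qnorm q.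
Proof.
rewrite exprS {1}/theta mulr_suml /box3 big_allpairs_dep; apply: eq_bigr => a _.
by rewrite theta2E mulr_sumr; apply: eq_bigr => b _; rewrite -exprD.
Qed.

Lemma theta4E K : theta R K ^+ 4 = \sum_(q <- box4 K) (- 'X) ^+ qnorm q.
Proof.
rewrite (exprM _ 2 2) theta2E expr2 mulr_suml /box4 [RHS]big_allpairs_dep.
apply: eq_bigr => u _.
by rewrite mulr_sumr; apply: eq_bigr => v _; rewrite -exprD.
Qed.

Lemma coef_sum_Xnorm (s : seq quat) n :
  (\sum_(q <- s) (- 'X : {poly R}) ^+ qnorm q)`_n
  = (-1) ^+ n * (size [seq q <- s | qnorm q == n])%:R.
Proof.
rewrite coef_sum -sum1_size big_filter natr_sum mulr_sumr [RHS]big_mkcond.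
apply: eq_bigr => q _; rewrite -scaleN1r exprZn coefZ coefXn.
by rewrite eq_sym; case: eqP => [->|_]; rewrite ?mulr0.
Qed.

Lemma coef_theta3 K n : (n <= K)%N ->
  (theta R K ^+ 3)`_n = (-1) ^+ n * (size (sphere3 n))%:R.
Proof.
move=> le_nK; rewrite theta3E coef_sum_Xnorm; congr (_ * _%:R).
apply: perm_size; apply: uniq_perm; rewrite ?filter_uniq ?box3_uniq // => q.
by rewrite !mem_sphere3.
Qed.

Lemma coef_theta4 K n : (n <= K)%N ->
  (theta R K ^+ 4)`_n = (-1) ^+ n * (size (sphere4 n))%:R.
Proof.
move=> le_nK; rewrite theta4E coef_sum_Xnorm; congr (_ * _%:R).
apply: perm_size; apply: uniq_perm; rewrite ?filter_uniq ?box4_uniq // => q.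
by rewrite !mem_sphere4.
Qed.

Lemma coef_theta0 K : (theta R K)`_0 = 1.
Proof.
elim: K => [|K IH]; first by rewrite /theta big_seq1 absz0 expr0 coef1.
by rewrite thetaS coefD IH coefMXn addr0.
Qed.

Definition code_series n : {poly R} :=
  \sum_(c : code n | is_overpartition (decode c)) 'X^(weight (decode c)).

Lemma coef_code_series n i : (i <= n)%N -> (code_series n)`_i = (nover i)%:R.
Proof.
move=> le_in; rewrite -(card_overpartitions le_in) coef_sum -sum1_card natr_sum.
rewrite [LHS]big_mkcond [RHS]big_mkcond; apply: eq_bigr => c _.
by rewrite inE coefXn eq_sym; case: is_overpartition; case: eqP.
Qed.

Lemma coef_code_series3 n : (code_series n ^+ 3)`_n = (pbar3 n)%:R.
Proof.
rewrite !exprS expr0 mulr1 mulrA /code_series big_distrlr /= pair_big /=.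
rewrite big_distrlr /= pair_big /= coef_sum /pbar3 -sum1_card natr_sum.
rewrite [LHS]big_mkcond [RHS]big_mkcond; apply: eq_bigr => c _.
rewrite inE /is_overpartition_triple -!exprD coefXn eq_sym.
by do 3!case: is_overpartition => //=; case: eqP.
Qed.

Definition pbar3_series K : {poly R} := \poly_(i < K) (pbar3 i)%:R.

Lemma pbar3_theta K : eqX K (pbar3_series K * theta R K ^+ 3) 1.
Proof.
rewrite -(expr1n _ 3); have := eqX_expr 3 (@over_theta R K); apply: eqX_trans.
rewrite exprMn; apply: eqXM => // i lt_iK; rewrite coef_poly lt_iK.
(* The series [code_series i] is known only up to degree [i], so each coefficient is compared
   separately, modulo X^(i+1). *)
rewrite -coef_code_series3; apply: (eqX_expr (K := i.+1)) => // j le_ji.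
by rewrite coef_code_series // coef_poly (leq_trans le_ji).
Qed.

End ThetaPowers.

(** * The ring of integer quaternions, conjugation and divisibility by integers *)

Lemma quat_ext x y : q_re x = q_re y -> q_i x = q_i y -> q_j x = q_j y ->
  q_k x = q_k y -> x = y.
Proof. by case: x y => a b c d [a' b' c' d'] /= -> -> -> ->. Qed.

Definition quat_add x y :=
  Quat (q_re x + q_re y) (q_i x + q_i y) (q_j x + q_j y) (q_k x + q_k y).
Definition quat_opp x := Quat (- q_re x) (- q_i x) (- q_j x) (- q_k x).
Definition quat_mul x y :=
  Quat (q_re x * q_re y - q_i x * q_i y - q_j x * q_j y - q_k x * q_k y)
       (q_re x * q_i y + q_i x * q_re y + q_j x * q_k y - q_k x * q_j y)
       (q_re x * q_j y - q_i x * q_k y + q_j x * q_re y + q_k x * q_i y)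
       (q_re x * q_k y + q_i x * q_j y - q_j x * q_i y + q_k x * q_re y).

Fact quat_addA : associative quat_add.
Proof. by move=> x y z; apply: quat_ext => /=; ring. Qed.
Fact quat_addC : commutative quat_add.
Proof. by move=> x y; apply: quat_ext => /=; ring. Qed.
Fact quat_add0 : left_id (Quat 0 0 0 0) quat_add.
Proof. by move=> x; apply: quat_ext => /=; ring. Qed.
Fact quat_addN : left_inverse (Quat 0 0 0 0) quat_opp quat_add.
Proof. by move=> x; apply: quat_ext => /=; ring. Qed.
HB.instance Definition _ :=
  GRing.isZmodule.Build quat quat_addA quat_addC quat_add0 quat_addN.

Fact quat_mulA : associative quat_mul.
Proof. by move=> x y z; apply: quat_ext => /=; ring. Qed.
Fact quat_mul1 : left_id (Quat 1 0 0 0) quat_mul.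
Proof. by move=> x; apply: quat_ext => /=; ring. Qed.
Fact quat_mulr1 : right_id (Quat 1 0 0 0) quat_mul.
Proof. by move=> x; apply: quat_ext => /=; ring. Qed.
Fact quat_mulDl : left_distributive quat_mul quat_add.
Proof. by move=> x y z; apply: quat_ext => /=; ring. Qed.
Fact quat_mulDr : right_distributive quat_mul quat_add.
Proof. by move=> x y z; apply: quat_ext => /=; ring. Qed.
Fact quat_1neq0 : Quat 1 0 0 0 != Quat 0 0 0 0.
Proof. by apply/eqP => -[]. Qed.
HB.instance Definition _ := GRing.Zmodule_isNzRing.Build quat
  quat_mulA quat_mul1 quat_mulr1 quat_mulDl quat_mulDr quat_1neq0.

Lemma quat_addE x y : x + y = quat_add x y. Proof. by []. Qed.
Lemma quat_oppE x : - x = quat_opp x. Proof. by []. Qed.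
Lemma quat_mulE x y : x * y = quat_mul x y. Proof. by []. Qed.
Lemma quat_1E : 1 = Quat 1 0 0 0. Proof. by []. Qed.
Lemma quat_0E : 0 = Quat 0 0 0 0. Proof. by []. Qed.

Lemma quat_natmulE x n :
  x *+ n = Quat (q_re x *+ n) (q_i x *+ n) (q_j x *+ n) (q_k x *+ n).
Proof. by elim: n => // n IH; rewrite !mulrS IH. Qed.

Lemma quat_mulzE x (m : int) :
  x *~ m = Quat (q_re x * m) (q_i x * m) (q_j x * m) (q_k x * m).
Proof.
rewrite -!mulrzz; case: m => n; first by rewrite -!pmulrn quat_natmulE.
by rewrite !NegzE !mulrNz -!pmulrn quat_natmulE.
Qed.

Definition quatE := (quat_addE, quat_oppE, quat_mulE, quat_1E, quat_0E, quat_mulzE).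

Lemma quat_intE (m : int) : m%:~R = Quat m 0 0 0.
Proof. by rewrite quat_mulzE /= mul1r !mul0r. Qed.

Definition conj x := Quat (q_re x) (- q_i x) (- q_j x) (- q_k x).

Lemma conjK : involutive conj.
Proof. by case=> a b c d; rewrite /conj /= !opprK. Qed.
Lemma conjM x y : conj (x * y) = conj y * conj x.
Proof. by rewrite /conj !quatE; apply: quat_ext => /=; ring. Qed.
Lemma conjMz x m : conj (x *~ m) = conj x *~ m.
Proof. by rewrite /conj !quatE; apply: quat_ext => /=; ring. Qed.

Lemma qnormE x :
  (qnorm x)%:Z = q_re x ^+ 2 + q_i x ^+ 2 + q_j x ^+ 2 + q_k x ^+ 2.
Proof. by rewrite /qnorm -!abszX !PoszD !gez0_abs ?sqr_ge0 ?addrA. Qed.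
Lemma mul_conj x : x * conj x = (qnorm x)%:~R.
Proof. by rewrite quat_intE qnormE !quatE; apply: quat_ext => /=; ring. Qed.
Lemma conj_mul x : conj x * x = (qnorm x)%:~R.
Proof. by rewrite quat_intE qnormE !quatE; apply: quat_ext => /=; ring. Qed.
Lemma qnormM x y : qnorm (x * y) = (qnorm x * qnorm y)%N.
Proof. by apply/eqP; rewrite -eqz_nat PoszM !qnormE !quatE /=; apply/eqP; ring. Qed.
Lemma qnorm_conj x : qnorm (conj x) = qnorm x.
Proof. by rewrite /qnorm /= !abszN. Qed.
Lemma qnormMz x (m : int) : qnorm (x *~ m) = (qnorm x * `|m| ^ 2)%N.
Proof. by rewrite /qnorm !quatE /= !abszM !expnMn !mulnDl. Qed.

Lemma quat_mulzI (m : int) : m != 0 -> injective (fun x : quat => x *~ m).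
Proof.
move=> m0 x y; rewrite !quatE => -[/(mulIf m0) ? /(mulIf m0) ? /(mulIf m0) ?
  /(mulIf m0) ?]; exact: quat_ext.
Qed.

Definition qdvd (m : int) x :=
  [&& (m %| q_re x)%Z, (m %| q_i x)%Z, (m %| q_j x)%Z & (m %| q_k x)%Z].

Lemma qdvdP m x : reflect (exists y, x = y *~ m) (qdvd m x).
Proof.
apply: (iffP and4P) => [[/dvdzP[a ea] /dvdzP[b eb] /dvdzP[c ec] /dvdzP[d ed]]|].
  by exists (Quat a b c d); rewrite quatE; apply: quat_ext.
by case=> y ->; rewrite quatE /= !dvdz_mull.
Qed.

Lemma qdvdD m x y : qdvd m x -> qdvd m y -> qdvd m (x + y).
Proof.
by move=> /qdvdP[a ->] /qdvdP[b ->]; apply/qdvdP; exists (a + b); rewrite mulrzDl.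
Qed.
Lemma qdvdN m x : qdvd m x -> qdvd m (- x).
Proof. by move=> /qdvdP[a ->]; apply/qdvdP; exists (- a); rewrite mulNrz. Qed.
Lemma qdvdB m x y : qdvd m x -> qdvd m y -> qdvd m (x - y).
Proof. by move=> ? ?; apply: qdvdD => //; apply: qdvdN. Qed.
Lemma qdvdMl m x y : qdvd m x -> qdvd m (y * x).
Proof. by move=> /qdvdP[a ->]; apply/qdvdP; exists (y * a); rewrite mulrzAr. Qed.
Lemma qdvdMr m x y : qdvd m x -> qdvd m (x * y).
Proof. by move=> /qdvdP[a ->]; apply/qdvdP; exists (a * y); rewrite mulrzAl. Qed.
Lemma qdvd_conj m x : qdvd m x -> qdvd m (conj x).
Proof. by move=> /qdvdP[a ->]; apply/qdvdP; exists (conj a); rewrite conjMz. Qed.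
Lemma qdvd_int m (n : int) : (m %| n)%Z -> qdvd m n%:~R.
Proof. by rewrite /qdvd quat_intE /= dvdz0 => ->. Qed.
Lemma qdvd_Mz m x : qdvd m (x *~ m).
Proof. by apply/qdvdP; exists x. Qed.
Lemma qdvd_qnorm (m : nat) x : qdvd m x -> (m ^ 2 %| qnorm x)%N.
Proof. by move=> /qdvdP[y ->]; rewrite qnormMz absz_nat dvdn_mull. Qed.

Lemma qdvd_coprime (m n : int) x : coprimez m n -> qdvd m (x *~ n) -> qdvd m x.
Proof. by move=> co; rewrite /qdvd quat_mulzE /= !Gauss_dvdzl. Qed.

Lemma qnorm_congr (m : nat) x y : qdvd m (x - y) -> (m %| qnorm x)%N = (m %| qnorm y)%N.
Proof.
move=> d; suff : (m%:Z %| (qnorm x)%:Z - (qnorm y)%:Z)%Z.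
  move=> h; rewrite -[LHS]/(m%:Z %| (qnorm x)%:Z)%Z -[RHS]/(m%:Z %| (qnorm y)%:Z)%Z.
  by rewrite -(subrK (qnorm y)%:Z (qnorm x)%:Z) rpredDl.
have /qdvdP[z /(canRL (subrK _)) ->] := d.
rewrite !qnormE !quatE /=; apply/dvdzP.
exists (q_re z * (q_re z * m + 2 * q_re y) + q_i z * (q_i z * m + 2 * q_i y)
  + q_j z * (q_j z * m + 2 * q_j y) + q_k z * (q_k z * m + 2 * q_k y)); ring.
Qed.

(** * Four squares modulo 7 *)

Lemma mem_sphere4E n q : (q \in sphere4 n) = (qnorm q == n).
Proof. exact: mem_sphere4. Qed.

Lemma mem_sphere3E n q : (q \in sphere3 n) = (q_re q == 0) && (qnorm q == n).
Proof. exact: mem_sphere3. Qed.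

Lemma pureP x : reflect (conj x = - x) (q_re x == 0).
Proof.
apply: (iffP eqP) => [x0|[e]]; last by lia.
by rewrite quatE; apply: quat_ext => //=; rewrite x0.
Qed.

Lemma quat_mulIn (p : nat) x : (0 < p)%N -> qnorm x = p -> injective (fun y => x * y).
Proof.
move=> p0 nx y z /(congr1 (fun t => conj x * t)); rewrite !mulrA conj_mul nx.
by rewrite !mulrzl; apply: quat_mulzI; rewrite eqz_nat -lt0n.
Qed.

(** Multiplying conj x q = p y by x on the left and cancelling p gives q = x y, and conversely; the
    norm is multiplicative. *)
Lemma left_multiples_sphere4 p n x : (0 < p)%N -> qnorm x = p ->
  perm_eq [seq q <- sphere4 (p * n) | qdvd p (conj x * q)]
          [seq x * q | q <- sphere4 n].
Proof.
move=> p0 nx; apply: uniq_perm.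
- exact: filter_uniq (sphere4_uniq _).
- by rewrite map_inj_uniq ?sphere4_uniq //; apply: quat_mulIn nx.
move=> q; rewrite mem_filter mem_sphere4E; apply/andP/mapP.
  case=> /qdvdP[y ey] /eqP nq; have eq : q = x * y.
    apply: (@quat_mulzI p); first by rewrite eqz_nat -lt0n.
    by rewrite /= -mulrzAr -ey mulrA mul_conj nx mulrzl.
  exists y => //; move: nq; rewrite mem_sphere4E eq qnormM nx => /eqP.
  by rewrite eqn_pmul2l.
case=> y; rewrite mem_sphere4E => /eqP ny ->.
by rewrite mulrA conj_mul nx mulrzl qdvd_Mz qnormM nx ny.
Qed.

Definition norm7 : seq quat :=
  [seq Quat 2 a b.1 b.2 | a <- [:: 1; -1],
                          b <- [:: (1, 1); (1, -1); (-1, 1); (-1, -1)]].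

(** Both conditions depend only on the coordinates modulo 7, so 7^4 cases suffice. A [q] divisible
    by 7 is counted for all eight quaternions, which is still 1 modulo 7. *)
Definition check7 : bool :=
  let r := [seq Posz i | i <- iota 0 7] in
  all (fun a => all (fun b => all (fun c => all (fun d =>
    let q := Quat a b c d in
    (7 %| qnorm q) ==>
    (count (fun x => qdvd 7 (quat_mul (conj x) q)) norm7 %% 7 == 1))%N r) r) r) r.

Lemma check7_true : check7.
Proof. by vm_compute. Qed.

Lemma qdvd_congr m x y z : qdvd m (y - z) -> qdvd m (x * y) = qdvd m (x * z).
Proof.
move=> yz; apply/idP/idP => h.
  by rewrite -[z](subKr y) mulrBr qdvdB // qdvdMl.
by rewrite -[y](subrK z) mulrDr qdvdD // qdvdMl.
Qed.

Lemma count_norm7 q : (7 %| qnorm q)%N ->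
  (count (fun x => qdvd 7 (conj x * q)%R) norm7 %% 7 = 1)%N.
Proof.
pose res (a : int) : int := (a %% 7)%Z.
pose q' := Quat (res (q_re q)) (res (q_i q)) (res (q_j q)) (res (q_k q)).
have dres a : (7 %| a - res a)%Z by rewrite -eqz_mod_dvd modz_mod.
have dq : qdvd 7 (q - q') by rewrite /qdvd !quatE /= !dres.
have -> : count (fun x => qdvd 7 (conj x * q)) norm7 =
  count (fun x => qdvd 7 (conj x * q')) norm7.
  by apply: eq_count => x; apply: qdvd_congr.
rewrite (qnorm_congr dq) => nq'.
have mem_res a : res a \in [seq Posz i | i <- iota 0 7].
  rewrite /res; have := modz_ge0 a (isT : 7 != 0 :> int).
  have := ltz_pmod a (isT : 0 < 7 :> int).
  by case: (modz a 7) => // n; rewrite ltz_nat mem_map // ?mem_iota // => ? ? [].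
have /allP/(_ _ (mem_res (q_re q)))/allP/(_ _ (mem_res (q_i q))) := check7_true.
move=> /allP/(_ _ (mem_res (q_j q)))/allP/(_ _ (mem_res (q_k q))).
by move=> /implyP/(_ nq')/eqP.
Qed.

(** The pairs (x, q) with q in x H are counted twice: each of the eight x contributes r4(n), and 8 =
    1 modulo 7, while each q contributes 1 modulo 7. *)
Lemma size_sphere4_mul7 n : size (sphere4 (7 * n)) = size (sphere4 n) %[mod 7].
Proof.
have e : (\sum_(q <- sphere4 (7 * n)) count (fun x => qdvd 7 (conj x * q)%R) norm7
    = 8 * size (sphere4 n))%N.
  under eq_bigr do rewrite -sum1_count big_mkcond.
  rewrite exchange_big big_seq /= (eq_bigr (fun=> size (sphere4 n))).
    by rewrite -big_seq big_const_seq count_predT iter_addn_0 mulnC.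
  move=> x /(allP (isT : all (fun x => qnorm x == 7%N) norm7)) /eqP nx.
  rewrite -big_mkcond sum1_count -size_filter.
  by rewrite (perm_size (left_multiples_sphere4 n _ nx)) // size_map.
rewrite -[RHS](modnMDl (size (sphere4 n))) -mulnSr [(size _ * 8)%N]mulnC -e -sum1_size.
rewrite -modn_summ -[RHS]modn_summ !big_seq; congr (_ %% _)%N.
apply: eq_bigr => q; rewrite mem_sphere4E => /eqP nq.
by rewrite count_norm7 ?nq ?dvdn_mulr.
Qed.

(** * Reduction of the generating function modulo 7 *)

Local Notation F7 := 'F_7.

Lemma frob7 (p : {poly F7}) : p ^+ 7 = p \Po 'X^7.
Proof.
have ch : 7 \in [pchar {poly F7}].
  by rewrite inE /= -polyC_natr polyC_eq0 pchar_Fp_0.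
have c7 (c : F7) : c ^+ 7 = c.
  by case: c => -[|[|[|[|[|[|[|c]]]]]]] lt_c //; apply: val_inj.
elim/poly_ind: p => [|p c IH]; first by rewrite comp_poly0 expr0n.
rewrite (exprDn_pchar _ _ (_ : [pchar {poly F7}].-nat 7)); last first.
  by rewrite (eq_pnat _ (pcharf_eq ch)) pnat_id.
rewrite exprMn IH comp_polyD comp_polyM comp_polyX comp_polyC.
by rewrite -[in LHS]polyC_exp c7.
Qed.

(** Extracting the exponents divisible by 7 is linear over the polynomials in X^7. *)
Lemma coef_mul_compX7 (p q r : {poly F7}) m :
  (forall i, (i <= m)%N -> r`_i = p`_(7 * i)) ->
  (p * (q \Po 'X^7))`_(7 * m) = (r * q)`_m.
Proof.
move=> er; rewrite comp_polyE -[X in r * X]coefK poly_def !mulr_sumr !coef_sum.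
apply: eq_bigr => i _; rewrite -!scalerAr !coefZ -exprM !coefMXn ltn_pmul2l //.
by case: ltnP => // le_im; rewrite -mulnBr er ?leq_subr.
Qed.

(** Write P for the series of [pbar3] and t for theta. Then P t^3 = 1 gives P t(X^7) = P t^7 = t^4.
    Extraction of the exponents [7 * i] turns the left side into [r * t] and leaves t^4 unchanged,
    by the congruence for r4; cancelling t gives [r] = t^3. *)
Lemma pbar3_mul7 m :
  (pbar3 (7 * m))%:R = (-1) ^+ m * (size (sphere3 m))%:R :> F7.
Proof.
set K := (7 * m).+1; set t := theta F7 K.
pose r : {poly F7} := \poly_(i < m.+1) (pbar3 (7 * i))%:R.
have le_mK : (m <= K)%N by rewrite /K; lia.
have er i : (i <= m)%N -> r`_i = (pbar3_series F7 K)`_(7 * i).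
  by move=> le_im; rewrite !coef_poly !ltnS le_im leq_pmul2l ?le_im.
suff h : eqX m.+1 r (t ^+ 3).
  by rewrite -(coef_theta3 F7 le_mK) -h // coef_poly ltnSn.
apply: (@eqX_cancel _ _ t); first exact: coef_theta0.
move=> i lt_im; rewrite -exprS mulrC -(@coef_mul_compX7 (pbar3_series F7 K)); last first.
  by move=> j le_ji; apply: er; rewrite (leq_trans le_ji).
have le_iK : (7 * i < K)%N by rewrite ltnS leq_pmul2l.
rewrite -frob7 -/t (exprD _ 3 4) mulrA.
rewrite (eqXM (@pbar3_theta F7 K) (fun _ _ => erefl)) // mul1r.
rewrite !coef_theta4 -1?ltnS ?(leq_trans lt_im) //; try lia.
congr (_ * _); first by rewrite exprM -signr_odd.
by rewrite -(Fp_nat_mod (isT : prime 7)) size_sphere4_mul7 Fp_nat_mod.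
Qed.

(** * Sums of three squares *)

(** The inverse of v |-> x v conj(x) is w |-> conj(x) w x / p^2, and both maps preserve pure
    quaternions. *)
Lemma conj_multiples_sphere3 p n x : (0 < p)%N -> qnorm x = p ->
  perm_eq [seq w <- sphere3 (p ^ 2 * n)%N | qdvd (p ^ 2)%N (conj x * w * x)]
          [seq x * v * conj x | v <- sphere3 n].
Proof.
move=> p0 nx.
have p2 : (p ^ 2)%N%:Z = p%:Z * p%:Z by rewrite -mulnn PoszM.
have conj_inv v : conj x * (x * v * conj x) * x = v *~ (p ^ 2)%N.
  rewrite -!mulrA conj_mul mulrA conj_mul nx mulrzl mulrzr.
  by rewrite p2 mulrzA.
have inj : injective (fun v => x * v * conj x).
  move=> v w /(congr1 (fun t => conj x * t * x)); rewrite !conj_inv.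
  by apply: quat_mulzI; rewrite eqz_nat expn_eq0 eqn0Ngt p0.
apply: uniq_perm.
- exact: filter_uniq (sphere3_uniq _).
- by rewrite map_inj_uniq ?sphere3_uniq.
have norm_inv v : qnorm (x * v * conj x) = (p ^ 2 * qnorm v)%N.
  by rewrite !qnormM qnorm_conj nx mulnAC mulnn.
have pure_inv v : conj v = - v -> conj (x * v * conj x) = - (x * v * conj x).
  by move=> cv; rewrite !conjM conjK cv mulNr mulrN mulrA.
have p20 : (0 < p ^ 2)%N by rewrite expn_gt0 p0.
move=> w; rewrite mem_filter mem_sphere3E; apply/andP/mapP.
  case=> /qdvdP[y ey] /andP[/pureP wpure] /eqP nw.
  have ew : w = x * y * conj x.
    apply: (@quat_mulzI (p ^ 2)%N); first by rewrite eqz_nat -lt0n.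
    rewrite /= -mulrzAl -mulrzAr -ey -!mulrA mul_conj !mulrA mul_conj nx.
    by rewrite mulrzl mulrzr p2 mulrzA.
  have py : conj y = - y.
    apply: (@quat_mulzI (p ^ 2)%N); first by rewrite eqz_nat -lt0n.
    by rewrite /= -conjMz mulNrz -ey !conjM conjK wpure mulNr mulrN mulrA.
  exists y => //; rewrite mem_sphere3E; apply/andP; split; first exact/pureP.
  by move/eqP: nw; rewrite ew norm_inv eqn_pmul2l.
case=> v; rewrite mem_sphere3E => /andP[/pureP vpure /eqP nv] ->.
rewrite conj_inv qdvd_Mz norm_inv nv eqxx andbT; split=> //.
exact/pureP/pure_inv.
Qed.

(** * Balanced residues and Lagrange's descent *)

Definition bres (m : nat) (a : int) : int :=
  let r := (a %% m)%Z in if (2 * r <= m)%R then r else r - m%:Z.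

Lemma bresP m a : (0 < m)%N -> (m %| a - bres m a)%Z /\ (2 * `|bres m a| <= m)%N.
Proof.
move=> m0; rewrite /bres; set r := (a %% m)%Z.
have r0 : 0 <= r by rewrite modz_ge0 // eqz_nat -lt0n.
have rm : r < m by rewrite ltz_pmod.
have dr : (m %| a - r)%Z by rewrite -eqz_mod_dvd modz_mod.
case: ifP => h; split=> //; try lia.
rewrite (_ : a - _ = (a - r) + m%:Z); last by ring.
by rewrite rpredD.
Qed.

Definition qres m x :=
  Quat (bres m (q_re x)) (bres m (q_i x)) (bres m (q_j x)) (bres m (q_k x)).

Lemma qdvd_qres m x : (0 < m)%N -> qdvd m (x - qres m x).
Proof.
move=> m0; rewrite /qdvd /qres !quatE /=.
by do ![rewrite (bresP _ m0).1].
Qed.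

(** A balanced residue is at most m/2 in absolute value, and strictly less when [m] is odd, so each
    of the four squares is below m^2/4. *)
Lemma qnorm_qres m x : odd m -> (qnorm (qres m x) < m ^ 2)%N.
Proof.
move=> m_odd; have m0 : (0 < m)%N by case: m m_odd.
have sq a : (4 * `|bres m a| ^ 2 < m ^ 2)%N.
  rewrite (_ : 4 = 2 ^ 2)%N // -expnMn ltn_sqr ltn_neqAle (bresP a m0).2 andbT.
  by apply/eqP => e; move: m_odd; rewrite -e oddM.
rewrite -(ltn_pmul2l (isT : 0 < 4)%N) /qnorm /=.
have := sq (q_re x); have := sq (q_i x); have := sq (q_j x); have := sq (q_k x).
lia.
Qed.

Lemma qnorm_eq0 x : (qnorm x == 0) = (x == 0).
Proof.
apply/eqP/eqP => [|->]; last by rewrite quatE.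
rewrite /qnorm => h; rewrite quatE.
have sq0 (a : int) : (`|a| ^ 2 = 0)%N -> a = 0.
  by move/eqP; rewrite expn_eq0 absz_eq0 andbT => /eqP.
move/eqP: h; rewrite !addn_eq0 => /andP[/andP[/eqP ? /eqP ?] /andP[/eqP ? /eqP ?]].
by apply: quat_ext; apply: sq0.
Qed.

(** One of 1 + i, 1 + j, 1 + k serves as [u]; this is checked on the 16 residue classes modulo 2. *)
Lemma dvd2_unit x : (2 %| qnorm x)%N -> exists2 u, qnorm u = 2 & qdvd 2 (x * u).
Proof.
pose y := Quat (q_re x %% 2)%Z (q_i x %% 2)%Z (q_j x %% 2)%Z (q_k x %% 2)%Z.
have dxy : qdvd 2 (x - y).
  by rewrite /qdvd !quatE /= -!eqz_mod_dvd !modz_mod !eqxx.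
rewrite (qnorm_congr dxy).
suff check : (2 %| qnorm y)%N -> has (fun u => qdvd 2 (y * u))
    [:: Quat 1 1 0 0; Quat 1 0 1 0; Quat 1 0 0 1].
  move=> /check/hasP[u u_in yu]; exists u.
    by move: u_in; rewrite !inE => /or3P[] /eqP->.
  by rewrite -(subrK y x) mulrDl qdvdD // qdvdMr.
have mod2 a : (a %% 2)%Z = 0 \/ (a %% 2)%Z = 1 by lia.
rewrite /y; case: (mod2 (q_re x)) => ->; case: (mod2 (q_i x)) => ->;
case: (mod2 (q_j x)) => ->; case: (mod2 (q_k x)) => ->; by vm_compute.
Qed.

Section OddPrime.
Variables (p : nat) (p_prime : prime p) (p_odd : odd p).

Let p_gt0 : (0 < p)%N. Proof. exact: prime_gt0. Qed.

(* Lagrange's descent, within the right ideal of the y such that p | x y. *)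
Lemma exists_norm_descent x m y : ~~ qdvd p x -> qdvd p (x * y) ->
  qnorm y = (m * p)%N -> (0 < m < p)%N ->
  exists2 z, qnorm z = p & qdvd p (x * z).
Proof.
move=> px; elim/ltn_ind: m y => m IH y xy ny /andP[m0 lt_mp].
have [m1|m_gt1] := leqP m 1.
  have em : m = 1%N by apply/eqP; rewrite eqn_leq m1.
  by exists y => //; rewrite ny em mul1n.
have [t [m' [[lt_m' m'0] xt nt]]] : exists t m',
    [/\ (m' < m)%N /\ (0 < m')%N, qdvd p (x * t) & qnorm t = (m' * p)%N].
  (* For even [m], y u = 2 t with N(u) = 2 gives N(t) = (m/2) p, and the factor 2 is invertible
     modulo [p]. *)
  have [m_odd|m_even] := boolP (odd m); last first.
    have [|u nu /qdvdP[t et]] := @dvd2_unit y.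
      by rewrite ny dvdn2 oddM p_odd andbT.
    have m2 : (m = m./2 * 2)%N by rewrite muln2 even_halfK.
    exists t, m./2; split; first by split; lia.
      apply: (@qdvd_coprime _ 2); last by rewrite -mulrzAr -et mulrA qdvdMr.
      by rewrite coprimezE coprimen2.
    have := congr1 qnorm et; rewrite qnormM qnormMz ny nu /= => e.
    by apply/eqP; rewrite -(eqn_pmul2r (isT : 0 < 4)%N) -e {1}m2; apply/eqP; ring.
  (* Modulo [m], y z is y conj(y) = m p, hence 0, so y z = m t. With N(z) = m' m this yields N(t) =
     m' p, and m' < m because N(z) < m^2. *)
  pose z := qres m (conj y); have dz : qdvd m (conj y - z) by apply: qdvd_qres.
  have nz : (m %| qnorm z)%N by rewrite -(qnorm_congr dz) qnorm_conj ny dvdn_mulr.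
  have lt_z : (qnorm z < m ^ 2)%N by apply: qnorm_qres.
  (* If z were 0, then [m] would divide y, so m^2 would divide m p and [m] would equal [p]. *)
  have z0 : (0 < qnorm z)%N.
    rewrite lt0n qnorm_eq0; apply/eqP => ez; move: dz; rewrite ez subr0 => dy.
    have := qdvd_qnorm dy; rewrite qnorm_conj ny -mulnn dvdn_pmul2l //.
    move=> /(prime_nt_dvdP p_prime (negbT (gtn_eqF m_gt1))) em.
    by rewrite em ltnn in lt_mp.
  have /dvdnP[m' em'] := nz.
  have /qdvdP[t et] : qdvd m (y * z).
    rewrite -[z](subKr (conj y)) mulrBr mul_conj qdvdB ?qdvdMl //.
    by apply: qdvd_int; rewrite ny; apply: dvdn_mulr.
  exists t, m'; split.
  - by move: lt_z z0; rewrite em' -mulnn ltn_pmul2r // muln_gt0 => -> /andP[].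
  - apply: (@qdvd_coprime _ m); last by rewrite -mulrzAr -et mulrA qdvdMr.
    by rewrite coprimezE prime_coprime // gtnNdvd.
  have := congr1 qnorm et; rewrite qnormM qnormMz ny em' absz_nat => e.
  have m20 : (0 < m ^ 2)%N by rewrite expn_gt0 m0.
  apply/eqP; rewrite -(eqn_pmul2r m20) -e -mulnn; apply/eqP; ring.
by apply: (IH m') nt _ => //; rewrite m'0 (ltn_trans lt_m').
Qed.

(** The descent starts from the balanced residue of conj(x) modulo [p]: it has norm m p with m < p,
    and m is not 0 since [p] does not divide x. *)
Lemma exists_norm x : ~~ qdvd p x -> (p %| qnorm x)%N ->
  exists2 y, qnorm y = p & qdvd p (x * y).
Proof.
move=> px nx; pose z := qres p (conj x).
have dz : qdvd p (conj x - z) by apply: qdvd_qres.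
have /dvdnP[m em] : (p %| qnorm z)%N by rewrite -(qnorm_congr dz) qnorm_conj.
apply: (@exists_norm_descent x m z) => //.
  rewrite -[z](subKr (conj x)) mulrBr mul_conj qdvdB ?qdvdMl //.
  exact: qdvd_int.
have lt_z := qnorm_qres (conj x) p_odd; rewrite -/z em -mulnn ltn_pmul2r // in lt_z.
rewrite lt_z andbT lt0n; apply: contra px => /eqP m0.
move: em; rewrite m0 mul0n => /eqP; rewrite qnorm_eq0 => /eqP ez.
by move: dz; rewrite ez subr0 => /qdvd_conj; rewrite conjK.
Qed.

Let coprime_p (a : int) : ~~ (p %| a)%Z -> coprimez p a.
Proof. by move=> pa; rewrite coprimezE prime_coprime. Qed.

(** The trace form is nondegenerate modulo an odd prime: if c is a coordinate of [r] prime to [p]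
    and 2 c s = 1 modulo [p], then [z] is, up to sign, s times the matching basis element. *)
Lemma exists_trace1 r : ~~ qdvd p r ->
  exists z, qdvd p (1 - (r * z + conj (r * z))).
Proof.
have inv2 (c : int) : ~~ (p %| c)%Z -> exists s, (p %| 1 - 2 * c * s)%Z.
  move=> pc; have : coprimez p (2 * c).
    rewrite coprimezMr (coprime_p pc) andbT coprimezE.
    by rewrite coprime_sym coprime2n.
  case/coprimezP=> -[u v] /= e; exists v; apply/dvdzP; exists u; rewrite -{1}e; ring.
have tr z : r * z + conj (r * z) = (2 * q_re (r * z))%:~R.
  by rewrite quat_intE /conj !quatE; apply: quat_ext => /=; ring.
have fin c t z : q_re (r * z) = c * t -> (p %| 1 - 2 * c * t)%Z ->
    exists z, qdvd p (1 - (r * z + conj (r * z))).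
  move=> e h; exists z; rewrite tr -[X in X - _]/(1%:~R) -mulrzBr.
  by apply: qdvd_int; rewrite e mulrA.
rewrite /qdvd !negb_and => /or4P[] /inv2[s es]; move: es.
- by apply: (fin _ _ (Quat s 0 0 0)); rewrite quatE /=; ring.
- by apply: (fin _ _ (Quat 0 (- s) 0 0)); rewrite quatE /=; ring.
- by apply: (fin _ _ (Quat 0 0 (- s) 0)); rewrite quatE /=; ring.
- by apply: (fin _ _ (Quat 0 0 0 (- s))); rewrite quatE /=; ring.
Qed.

(* If z is such that r z + conj (r z) = 1 then, modulo p, 1 = r z - conj z r. *)
Lemma qdvd_annihilator a r b : ~~ qdvd p r -> qdvd p (conj r + r) ->
  qdvd p (a * r) -> qdvd p (r * b) -> qdvd p (a * b).
Proof.
move=> /exists_trace1[z ez] rr ar rb.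
have -> : a * b = a * (1 - (r * z + conj (r * z))) * b + a * r * (z * b)
   + (a * conj z * (conj r + r) * b - a * conj z * (r * b)).
  rewrite conjM mulrBr mulr1 mulrBl !mulrDr !mulrDl !mulrA.
  by rewrite addrK -[X in _ = X]addrA subrK.
rewrite !(qdvdD, qdvdN) ?(qdvdMr _ ar) ?(qdvdMl _ rb) //.
- by rewrite qdvdMr ?qdvdMl.
- by rewrite qdvdMr ?qdvdMl.
Qed.
End OddPrime.

Lemma mul_pure x : conj x = - x -> x * x = - (qnorm x)%:~R.
Proof. by move=> cx; rewrite -mul_conj cx mulrN opprK. Qed.

(** * The quaternion of norm p attached to an isotropic pure quaternion *)

Section Neighbour.
Variables (p : nat) (p_prime : prime p) (p_odd : odd p).
Variables (x y : quat) (x_pure : conj x = - x) (px : ~~ qdvd p x).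
Hypotheses (nx : (p %| qnorm x)%N) (ny : qnorm y = p) (xy : qdvd p (x * y)).

Let p0 : (p : int) != 0. Proof. by rewrite eqz_nat -lt0n prime_gt0. Qed.

Let qdvd_sqr v : conj v = - v -> (p %| qnorm v)%N -> qdvd p (v * v).
Proof. by move=> cv nv; rewrite mul_pure // qdvdN // qdvd_int. Qed.

Let cy_x : qdvd p (conj y * x).
Proof.
have := qdvd_conj xy; rewrite conjM x_pure mulrN => /qdvdN.
by rewrite opprK.
Qed.

Let x_plus : qdvd p (conj x + x).
Proof. by rewrite x_pure addNr; apply/qdvdP; exists 0; rewrite mul0rz. Qed.

Let factor w : conj w = - w -> qdvd p (conj y * w) ->
  exists2 s, w = y * s & w = - (conj s * conj y).
Proof.
move=> cw /qdvdP[s es]; have ew : w = y * s.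
  apply: (quat_mulzI p0); rewrite /= -mulrzAr -es mulrA mul_conj ny.
  by rewrite mulrzl.
by exists s => //; rewrite -conjM -ew cw opprK.
Qed.

(** Since x = y t = - conj(t) conj(y), the hypothesis gives p | x v x, which forces p to divide the
    trace c of x v. Modulo p, x v is annihilated by x on the left and by v on the right, so
    [qdvd_annihilator] with r = x v concludes. *)
Lemma qdvd_conj_orth v : conj v = - v -> (p %| qnorm v)%N ->
  qdvd p (conj y * v * y) -> qdvd p (x * v).
Proof.
move=> cv nv yvy; apply/negPn/negP => pxv.
have [t ex ex'] := factor x_pure cy_x.
have xvx : qdvd p (x * v * x).
  rewrite {1}ex' {1}ex !mulNr qdvdN //.
  by rewrite mulrA; apply: qdvdMr; rewrite -!mulrA; apply: qdvdMl; rewrite mulrA.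
pose c := q_re (x * v) *+ 2.
have tr : x * v + conj (x * v) = c%:~R.
  by rewrite quat_intE /c /conj !quatE; apply: quat_ext => /=; ring.
have pc : (p %| c)%Z.
  apply/negPn/negP => pc; case/negP: px; apply: (@qdvd_coprime _ c).
    by rewrite coprimezE prime_coprime.
  (* As conj(x v) = v x, this is c x = x v x + v x x, where x x = - N(x). *)
  rewrite -mulrzl -tr mulrDl conjM x_pure cv mulrNN qdvdD //.
  by rewrite -mulrA qdvdMl // qdvd_sqr.
case/negP: (pxv); apply: (@qdvd_annihilator p p_prime p_odd x (x * v) v) => //.
- by rewrite addrC tr qdvd_int.
- by rewrite mulrA qdvdMr // qdvd_sqr.
- by rewrite -mulrA qdvdMl // qdvd_sqr.
Qed.

(** The annihilator argument with middle factor [x], whose trace is 0. *)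
Lemma qdvd_orth_conj v : qdvd p (x * v) -> qdvd p (conj y * v).
Proof. move=> xv; exact: (qdvd_annihilator p_prime p_odd px x_plus cy_x xv). Qed.

Lemma neighbour_multiple v : conj v = - v -> (p %| qnorm v)%N ->
  qdvd (p ^ 2)%N (conj y * (v *~ p) * y) = qdvd p (x * v).
Proof.
move=> cv nv; have -> : qdvd (p ^ 2)%N (conj y * (v *~ p) * y) =
   qdvd p (conj y * v * y).
  rewrite mulrzAr mulrzAl /qdvd !quat_mulzE -mulnn PoszM /=.
  by rewrite !dvdz_mul2r.
apply/idP/idP => [|xv]; first exact: qdvd_conj_orth.
by rewrite qdvdMr // qdvd_orth_conj.
Qed.

(* Here w = y s and conj y w y = p (s y), where s y is annihilated modulo p by y on
   the left and by s on the right: if p did not divide s y, it would divide y s. *)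
Lemma neighbour_primitive w : conj w = - w -> (p ^ 2 %| qnorm w)%N ->
  ~~ qdvd p w -> qdvd (p ^ 2)%N (conj y * w * y) = qdvd p (x * w).
Proof.
move=> cw nw pw; have nw1 : (p %| qnorm w)%N.
  by apply: dvdn_trans nw; rewrite -mulnn dvdn_mulr.
apply/idP/idP => [/qdvdP[z ez]|xw].
  apply: qdvd_conj_orth => //; rewrite ez -mulnn PoszM mulrzA; exact: qdvd_Mz.
have cyw := qdvd_orth_conj xw; have [s ew ew'] := factor cw cyw.
have eyw : conj y * w * y = (s * y) *~ p.
  by rewrite ew mulrA conj_mul ny mulrzl mulrzAl.
suff /qdvdP[z ez] : qdvd p (s * y).
  by rewrite eyw ez -mulrzA -PoszM mulnn qdvd_Mz.
have cr : conj (s * y) = - (s * y).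
  apply: (quat_mulzI p0); rewrite /= -conjMz -eyw mulNrz -eyw.
  by rewrite !conjM conjK cw mulNr mulrN mulrA.
apply/negPn/negP => pr; case/negP: pw; rewrite ew.
apply: (@qdvd_annihilator p p_prime p_odd y (s * y)) => //.
- by rewrite cr addNr; apply/qdvdP; exists 0; rewrite mul0rz.
- rewrite mulrA -ew ew' mulNr -mulrA conj_mul ny mulrzr qdvdN ?qdvd_Mz //.
- rewrite -[s * y]opprK -cr conjM mulNr -mulrA conj_mul qdvdN // mulrzr.
  have : (p %| qnorm s)%N.
    by move: nw; rewrite ew qnormM ny -mulnn dvdn_pmul2l ?prime_gt0.
  by case/dvdnP=> k ->; rewrite PoszM mulrzA qdvd_Mz.
Qed.
End Neighbour.

(** * Counting isotropic vectors of F_p^3 *)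

Section Isotropic.
Variables (p : nat) (p_prime : prime p) (p_odd : odd p).
Local Notation F := 'F_p.
Local Notation T := (F * F * F)%type.

Lemma dvdz_Fp (m : int) : (p %| m)%Z = (m%:~R == 0 :> F).
Proof.
rewrite dvdzE /= (dvdn_pcharf (pchar_Fp p_prime)).
by case: m => n; rewrite ?NegzE ?mulrNz ?oppr_eq0 ?abszN.
Qed.

Let two_neq0 : 2 != 0 :> F.
Proof.
rewrite -(dvdn_pcharf (pchar_Fp p_prime)) (dvdn_prime2 p_prime) //.
by apply: contraTneq p_odd => ->.
Qed.

(* The sets of the values a^2 and -1 - b^2 both have (p+1)/2 elements. *)
Lemma sum_two_squares_Fp : exists a b : F, a ^+ 2 + b ^+ 2 = -1.
Proof.
have [h h2] : exists h, (h.*2 = p.+1)%N by exists p.+1./2; lia.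
pose sq (i : 'I_h) : F := (i%:R) ^+ 2.
have sq_inj : injective sq.
  move=> i j; rewrite /sq => /eqP; rewrite -subr_eq0 subr_sqr mulf_eq0.
  have ltp (k : 'I_h) : (k < p)%N.
    by apply: leq_trans (ltn_ord k) _; move: (prime_gt1 p_prime); lia.
  have natF (k l : nat) : (k < p)%N -> (l < p)%N -> k%:R = l%:R :> F -> k = l.
    move=> lk ll /(congr1 (@nat_of_ord _)); rewrite !val_Fp_nat //.
    by rewrite !modn_small.
  case/orP => [|]; first by rewrite subr_eq0 => /eqP/natF => e; apply/val_inj/e.
  rewrite -natrD -(dvdn_pcharf (pchar_Fp p_prime)) => d.
  have : (i + j = 0)%N.
    apply/eqP; apply: contraLR d => ij; rewrite gtnNdvd ?lt0n //.
    by move: (ltn_ord i) (ltn_ord j); lia.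
  by move=> ij; apply: val_inj => /=; lia.
have neg_inj : injective (fun i => -1 - sq i) by move=> i j /addrI/oppr_inj/sq_inj.
pose A := [set sq i | i in 'I_h]; pose B := [set -1 - sq i | i in 'I_h].
have cA : #|A| = h by rewrite card_imset // card_ord.
have cB : #|B| = h by rewrite card_imset // card_ord.
have : (0 < #|A :&: B|)%N.
  have := cardsUI A B; rewrite cA cB addnn h2.
  have : (#|A :|: B| <= p)%N by rewrite -[X in (_ <= X)%N](card_Fp p_prime) max_card.
  by case: #|A :&: B| => // le_p; rewrite addn0 => e; rewrite e ltnn in le_p.
case/card_gt0P=> c; rewrite inE => /andP[/imsetP[i _ ci] /imsetP[j _ cj]].
by exists i%:R, j%:R; move: cj; rewrite ci /sq => ->; rewrite subrK.
Qed.

Definition normF (t : T) : F := t.1.1 ^+ 2 + t.1.2 ^+ 2 + t.2 ^+ 2.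

(* In suitable coordinates the form is 4uv - w^2. *)
Lemma card_cone : #|[set t : T | normF t == 0]| = (p ^ 2)%N.
Proof.
have [a [b ab]] := sum_two_squares_Fp.
(* Coordinates on the basis (a, b, 1), (-a, -b, 1), (b, -a, 0): the first two vectors are isotropic
   with scalar product 2, and the third has norm -1 and is orthogonal to both. *)
pose f (u v w : F) : T := ((u - v) * a + w * b, (u - v) * b - w * a, u + v).
pose fu (t : T) : F := (t.2 - (a * t.1.1 + b * t.1.2)) / 2.
pose fv (t : T) : F := (t.2 + (a * t.1.1 + b * t.1.2)) / 2.
pose fw (t : T) : F := a * t.1.2 - b * t.1.1.
have fK t : f (fu t) (fv t) (fw t) = t.
  case: t => -[x y] z; rewrite /f /fu /fv /fw /=; congr (_, _, _).
  - by transitivity (- (a ^+ 2 + b ^+ 2) * x); [field | rewrite ab opprK mul1r].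
  - by transitivity (- (a ^+ 2 + b ^+ 2) * y); [field | rewrite ab opprK mul1r].
  - by field.
have fuK u v w : fu (f u v w) = u.
  by transitivity (u + (u - v) * - (a ^+ 2 + b ^+ 2 + 1) / 2);
    [rewrite /fu /=; field | rewrite ab addNr oppr0 mulr0 mul0r addr0].
have fvK u v w : fv (f u v w) = v.
  by transitivity (v + (u - v) * (a ^+ 2 + b ^+ 2 + 1) / 2);
    [rewrite /fv /=; field | rewrite ab addNr mulr0 mul0r addr0].
have fwK u v w : fw (f u v w) = w.
  by transitivity (- (a ^+ 2 + b ^+ 2) * w);
    [rewrite /fw /=; ring | rewrite ab opprK mul1r].
have normf u v w : normF (f u v w) = 4 * u * v - w ^+ 2.
  transitivity ((a ^+ 2 + b ^+ 2) * ((u - v) ^+ 2 + w ^+ 2) + (u + v) ^+ 2).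
    by rewrite /normF /=; ring.
  by rewrite ab; ring.
have four_neq0 : 4 != 0 :> F by rewrite (_ : 4 = 2 * 2) ?mulf_neq0 //; ring.
(* Points of the cone 4 u v = w^2: a nonzero u determines v from w, while u = 0 forces w = 0 and
   leaves v free. *)
pose g (c : F * F) : T :=
  if c.1 == 0 then f 0 c.2 0 else f c.1 (c.2 ^+ 2 / (4 * c.1)) c.2.
pose g' (t : T) : F * F := (fu t, if fu t == 0 then fv t else fw t).
have gK : cancel g g'.
  case=> u w; rewrite /g /g' /=; case: ifP => [/eqP ->|u0].
    by rewrite fuK fvK eqxx.
  by rewrite fuK fwK u0.
have -> : (p ^ 2)%N = #|[set: F * F]| by rewrite cardsT card_prod card_Fp // mulnn.
rewrite -(card_imset _ (can_inj gK)); congr #|pred_of_set _|.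
apply/setP=> t; rewrite inE; apply/idP/imsetP => [|[[u w] _ ->]]; last first.
  rewrite /g /=; case: ifP => [_|/negbT u0]; rewrite normf.
    by rewrite mulr0 mul0r expr0n subrr.
  by rewrite subr_eq0; apply/eqP; field; rewrite u0 four_neq0.
rewrite -[t in normF t]fK normf subr_eq0 => /eqP e.
exists (g' t) => //; rewrite /g /g' /=; have [u0|u0] := eqVneq (fu t) 0.
  rewrite -[LHS]fK u0; congr (f _ _ _); apply/eqP.
  by move/eqP: e; rewrite u0 mulr0 mul0r eq_sym expf_eq0.
by rewrite -e -[LHS]fK; congr (f _ _ _); field; rewrite u0.
Qed.

Definition lift_quat (t : T) : quat :=
  Quat 0 (t.1.1 : nat)%:Z (t.1.2 : nat)%:Z (t.2 : nat)%:Z.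

Definition red_quat (x : quat) : T := ((q_i x)%:~R, (q_j x)%:~R, (q_k x)%:~R).

Lemma lift_quatK : cancel lift_quat red_quat.
Proof. by case=> -[a b] c; rewrite /red_quat /= -!pmulrn !natr_Zp. Qed.

Lemma qdvd_red x : q_re x = 0 -> qdvd p x = (red_quat x == 0).
Proof.
by move=> x0; rewrite /qdvd x0 dvdz0 !dvdz_Fp /red_quat -!pair_eqE /= /pair_eq /= andbA.
Qed.

Lemma dvd_qnorm_red x : q_re x = 0 -> (p %| qnorm x)%N = (normF (red_quat x) == 0).
Proof.
move=> x0; rewrite -[LHS]/(p %| (qnorm x)%:Z)%Z dvdz_Fp qnormE x0 /normF /=.
by rewrite expr0n add0r !rmorphD !rmorphXn.
Qed.

Definition isotropic : {set T} := [set t : T | (t != 0) && (normF t == 0)].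

Lemma mem_isotropic t : (t \in isotropic) =
  ~~ qdvd p (lift_quat t) && (p %| qnorm (lift_quat t))%N.
Proof. by rewrite inE qdvd_red // dvd_qnorm_red // lift_quatK. Qed.

Lemma card_isotropic : #|isotropic| = (p ^ 2 - 1)%N.
Proof.
rewrite -card_cone (cardsD1 (0 : T)) inE /normF !expr0n !addr0 eqxx addKn.
by congr #|pred_of_set _|; apply/setP => t; rewrite !inE.
Qed.

Lemma card_orth_div v : qdvd p v ->
  #|[set t in isotropic | qdvd p (lift_quat t * v)]| = (p ^ 2 - 1)%N.
Proof.
move=> pv; rewrite -card_isotropic; congr #|pred_of_set _|.
by apply/setP=> t; rewrite inE qdvdMl ?andbT.
Qed.

(* Modulo p, the product vanishes exactly when t and v are proportional. *)
Lemma card_orth v : q_re v = 0 -> ~~ qdvd p v -> (p %| qnorm v)%N ->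
  #|[set t in isotropic | qdvd p (lift_quat t * v)]| = (p - 1)%N.
Proof.
move=> v0; rewrite qdvd_red // dvd_qnorm_red //.
case: v v0 => _ b1 b2 b3 /= ->; rewrite /red_quat /normF /=.
set r1 : F := b1%:~R; set r2 : F := b2%:~R; set r3 : F := b3%:~R => r0 nr.
(* The product of two pure quaternions has minus their scalar product as real part and their cross
   product as pure part. *)
have orth t : qdvd p (lift_quat t * Quat 0 b1 b2 b3) =
  [&& t.1.1 * r1 + t.1.2 * r2 + t.2 * r3 == 0, t.1.2 * r3 - t.2 * r2 == 0,
      t.2 * r1 - t.1.1 * r3 == 0 & t.1.1 * r2 - t.1.2 * r1 == 0].
  case: t => -[x y] z; rewrite /qdvd !quatE /= !dvdz_Fp.
  rewrite !(rmorphB, rmorphD, rmorphM) /= -!pmulrn !natr_Zp -/r1 -/r2 -/r3.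
  congr [&& _, _, _ & _]; first by rewrite -oppr_eq0; congr (_ == _); ring.
  1-3: by congr (_ == _); ring.
pose scale (c : F) : T := (c * r1, c * r2, c * r3).
have scale_eq0 c : (scale c == 0) = (c == 0).
  have trip (t u : T) : t = u -> [/\ t.1.1 = u.1.1, t.1.2 = u.1.2 & t.2 = u.2].
    by move=> ->.
  apply/eqP/eqP => [/trip[/= e1 e2 e3]|->]; last by rewrite /scale !mul0r.
  apply/eqP; apply: contraNT r0 => c0; apply/eqP.
  have z r : c * r = 0 -> r = 0 by move/eqP; rewrite mulf_eq0 (negPf c0) => /eqP.
  by rewrite (z _ e1) (z _ e2) (z _ e3).
have scale_inj : injective scale.
  move=> c d e; apply/eqP; rewrite -subr_eq0 -scale_eq0.
  have -> : scale (c - d) = scale c - scale d by rewrite /scale !mulrBl.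
  by rewrite e subrr.
have -> : (p - 1)%N = #|[set~ (0 : F)]| by rewrite cardsC1 card_Fp // subn1.
rewrite -(card_imset _ scale_inj); congr #|pred_of_set _|; apply/setP => t.
rewrite inE orth; apply/andP/imsetP => [[]|[c c0 ->]]; last first.
  rewrite !inE in c0 *; rewrite scale_eq0 c0 /normF /scale /=.
  move/eqP: nr => nr; split.
    apply/eqP; transitivity (c ^+ 2 * (r1 ^+ 2 + r2 ^+ 2 + r3 ^+ 2)); first by ring.
    by rewrite nr mulr0.
  apply/and4P; split; apply/eqP; try ring.
  transitivity (c * (r1 ^+ 2 + r2 ^+ 2 + r3 ^+ 2)); first by ring.
  by rewrite nr mulr0.
rewrite inE => /andP[t0 _]; case: t t0 => -[x y] z t0 /=.
case/and4P=> _; rewrite !subr_eq0 => /eqP e1 /eqP e2 /eqP e3.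
suff [c ec] : exists c, (x, y, z) = scale c.
  by exists c => //; rewrite !inE -scale_eq0 -ec.
rewrite /scale; move: r0; rewrite -!pair_eqE /= /pair_eq /= !negb_and -orbA.
case/or3P=> h.
- by exists (x / r1); rewrite divfK //; congr (_, _, _);
    [rewrite mulrAC e3 mulfK | rewrite mulrAC -e2 mulfK].
- by exists (y / r2); rewrite divfK //; congr (_, _, _);
    [rewrite mulrAC -e3 mulfK | rewrite mulrAC e1 mulfK].
- by exists (z / r3); rewrite divfK //; congr (_, _, _);
    [rewrite mulrAC e2 mulfK | rewrite mulrAC -e1 mulfK].
Qed.
End Isotropic.

(** If w = m u has norm m n, then N(u) = n / m. With [m] = p^2 this is the term r3(n / p^2). *)
Lemma size_multiples_sphere3 (m n : nat) : (0 < m)%N ->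
  size [seq w <- sphere3 (m * n) | qdvd m w] =
  if (m %| n)%N then size (sphere3 (n %/ m)) else 0%N.
Proof.
move=> m0; have m0' : m%:Z != 0 by rewrite eqz_nat -lt0n.
have norm_m u : (qnorm (u *~ m) == m * n)%N = (m * qnorm u == n)%N.
  by rewrite qnormMz absz_nat -mulnn mulnA mulnC eqn_pmul2l // mulnC.
case: ifP => [/dvdnP[k ->]|/negP mn].
  rewrite mulnK // -[RHS](size_map (fun u : quat => u *~ m)); apply: perm_size.
  apply: uniq_perm; first exact: filter_uniq (sphere3_uniq _).
    by rewrite map_inj_uniq ?sphere3_uniq //; apply: (quat_mulzI m0').
  have pure_m u : (q_re (u *~ m) == 0) = (q_re u == 0).
    by rewrite quat_mulzE /= mulf_eq0 (negPf m0') orbF.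
  move=> w; rewrite mem_filter mem_sphere3E; apply/idP/mapP.
    case/andP=> /qdvdP[u ->]; rewrite pure_m qnormMz absz_nat => /andP[u0 nu].
    exists u => //; rewrite mem_sphere3E u0 /=; move: nu.
    by rewrite mulnCA mulnn eqn_pmul2r // expn_gt0 m0.
  case=> u; rewrite mem_sphere3E => /andP[u0 /eqP nu] ->.
  by rewrite qdvd_Mz pure_m u0 qnormMz nu absz_nat mulnCA mulnn eqxx.
apply/eqP; rewrite size_filter -leqn0 leqNgt -has_count; apply/hasPn => w.
rewrite mem_sphere3E => /andP[_ nw]; apply/negP => /qdvdP[u eu]; apply: mn.
by move: nw; rewrite eu norm_m => /eqP <-; apply: dvdn_mulr.
Qed.

(** * The Hecke relation for sums of three squares *)

Section Hecke.
Variables (p : nat) (p_prime : prime p) (p_odd : odd p).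
Local Notation F := 'F_p.
Local Notation T := (F * F * F)%type.

Let p_gt0 : (0 < p)%N. Proof. exact: prime_gt0. Qed.

(** In the double count each of the p^2 - 1 isotropic t contributes r3(n), and each w contributes p
    - 1, or p^2 - 1 if p^2 | w. Since t runs over vectors instead of lines, everything carries a
    factor p - 1, which is cancelled at the end. *)
Lemma hecke_sphere3 n : (p %| n)%N ->
  (p.+1 * size (sphere3 n) = size (sphere3 (p ^ 2 * n)) +
   p * size [seq w <- sphere3 (p ^ 2 * n) | qdvd (p ^ 2)%N w])%N.
Proof.
(* [pi] chooses a quaternion of norm [p] for each isotropic [t]; elsewhere its value is a dummy
   0. *)
move=> pn; have /fin_all_exists[pi piP] (t : T) : exists y, t \in isotropic p ->
    qnorm y = p /\ qdvd p (lift_quat t * y).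
  have [t_in|t_out] := boolP (t \in isotropic p); last by exists 0.
  move: t_in; rewrite mem_isotropic // => /andP[pt nt].
  by have [y ny ty] := exists_norm p_prime p_odd pt nt; exists y.
have lift_pure (t : T) : conj (lift_quat t) = - lift_quat t by apply/pureP.
pose nb (t : T) w := qdvd (p ^ 2)%N (conj (pi t) * w * pi t).
have count_t : (\sum_(t in isotropic p) count (nb t) (sphere3 (p ^ 2 * n))
    = (p ^ 2 - 1) * size (sphere3 n))%N.
  rewrite (eq_bigr (fun=> size (sphere3 n))); last first.
    move=> t /piP[npi _]; rewrite -size_filter.
    by rewrite (perm_size (conj_multiples_sphere3 n p_gt0 npi)) size_map.
  by rewrite sum_nat_const card_isotropic.
have count_w w : w \in sphere3 (p ^ 2 * n) ->
   (\sum_(t in isotropic p) nb t w = (p - 1) + p * (p - 1) * qdvd (p ^ 2)%N w)%N.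
  rewrite mem_sphere3E => /andP[w_pure /eqP nw].
  have p2 : (p - 1 + p * (p - 1) = p ^ 2 - 1)%N by rewrite -mulnn; nia.
  have -> : (\sum_(t in isotropic p) nb t w = #|[set t in isotropic p | nb t w]|)%N.
    rewrite -sum1_card big_mkcond [RHS]big_mkcond; apply: eq_bigr => t _.
    by rewrite inE; case: (t \in _).
  have [/qdvdP[v ev]|pw] := boolP (qdvd p w); last first.
    have -> : qdvd (p ^ 2)%N w = false.
      apply/negbTE; apply: contra pw => /qdvdP[u ->].
      by rewrite -mulnn PoszM mulrzA qdvd_Mz.
    rewrite muln0 addn0 -(card_orth p_prime (eqP w_pure) pw); last first.
      by rewrite nw -mulnn -mulnA dvdn_mulr.
    apply: eq_card => t; rewrite [LHS]in_set [RHS]in_set; apply: andb_id2l => t_in.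
    have [npi tpi] := piP t t_in; move: t_in; rewrite mem_isotropic // => /andP[pt nt].
    apply: (neighbour_primitive p_prime p_odd (lift_pure t)) => //.
      exact/pureP.
    by rewrite nw dvdn_mulr.
  (* Here w = p v, and the hypothesis p | n makes v isotropic modulo [p]. *)
  have nv : qnorm v = n.
    move/eqP: nw; rewrite ev qnormMz absz_nat mulnC eqn_pmul2l ?expn_gt0 ?p_gt0 //.
    by move/eqP.
  have v_pure : q_re v == 0.
    move: w_pure; rewrite ev quat_mulzE /= mulf_eq0 orbC.
    by rewrite eqz_nat eqn0Ngt p_gt0.
  have -> : qdvd (p ^ 2)%N w = qdvd p v.
    by rewrite ev /qdvd !quat_mulzE -mulnn PoszM /= !dvdz_mul2r // eqz_nat -lt0n.
  have -> : [set t in isotropic p | nb t w] =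
      [set t in isotropic p | qdvd p (lift_quat t * v)].
    apply/setP => t; rewrite [LHS]in_set [RHS]in_set; apply: andb_id2l => t_in.
    have [npi tpi] := piP t t_in; move: t_in; rewrite mem_isotropic // => /andP[pt nt].
    rewrite /nb ev; apply: (neighbour_multiple p_prime p_odd (lift_pure t)) => //.
      exact/pureP.
    by rewrite nv.
  have [pv|pv] := boolP (qdvd p v); first by rewrite card_orth_div // muln1 p2.
  by rewrite muln0 addn0 card_orth ?nv //; apply/eqP.
have p1 : (0 < p - 1)%N by rewrite subn_gt0 prime_gt1.
apply/eqP; rewrite -(eqn_pmul2l p1); apply/eqP.
have -> : ((p - 1) * (p.+1 * size (sphere3 n)) = (p ^ 2 - 1) * size (sphere3 n))%N.
  by rewrite mulnA -mulnn; congr (_ * _)%N; nia.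
rewrite -count_t; under eq_bigr do rewrite -sum1_count big_mkcond.
rewrite exchange_big big_seq /=.
rewrite (eq_bigr (fun w => (p - 1) + p * (p - 1) * qdvd (p ^ 2)%N w)%N); last first.
  by move=> w /count_w <-; apply: eq_bigr => t _; case: (nb t w).
rewrite -big_seq big_split /= big_const_seq count_predT iter_addn_0 -big_distrr /=.
rewrite mulnDr mulnCA !mulnA; congr (_ + _ * _)%N.
by rewrite size_filter -sum1_count [RHS]big_mkcond;
  apply: eq_bigr => w _; case: (qdvd _ w).
Qed.
End Hecke.

(** * Odd powers of p and the congruences modulo 7 *)

(** The Hecke relation is the recurrence s(j+1) = (p + 1) s(j) - p s(j-1) with s(-1) = 0, because
    p^2 does not divide p N. Hence s(j+1) - s(j) = p^(j+1) s(0). *)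
Lemma size_sphere3_pow p N k : prime p -> odd p -> coprime N p ->
  (size (sphere3 (p ^ (2 * k + 1) * N)) =
   (\sum_(i < k.+1) p ^ i) * size (sphere3 (p * N)))%N.
Proof.
move=> p_prime p_odd coNp; have p0 := prime_gt0 p_prime.
pose s k := size (sphere3 (p ^ (2 * k + 1) * N)).
have p20 : (0 < p ^ 2)%N by rewrite expn_gt0 p0.
have expS j : (p ^ (2 * j.+1 + 1) * N = p ^ 2 * (p ^ (2 * j + 1) * N))%N.
  by rewrite mulnA -expnD; congr (p ^ _ * _)%N; lia.
have step j : (p.+1 * s j = s j.+1 + p * (if j is i.+1 then s i else 0))%N.
  rewrite /s hecke_sphere3 //; last by rewrite addn1 expnS -mulnA dvdn_mulr.
  rewrite size_multiples_sphere3 // expS; congr (_ + p * _)%N.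
  case: j => [|j].
    rewrite -mulnn expn1 dvdn_pmul2l // ifN //.
    by rewrite -prime_coprime // coprime_sym.
  by rewrite expS dvdn_mulr // mulKn.
have s0 : s 0%N = size (sphere3 (p * N)) by rewrite /s expn1.
have sS j : (s j.+1 = p ^ j.+1 * s 0%N + s j)%N.
  elim: j => [|j IH].
    by have := step 0%N; rewrite muln0 addn0 mulSn => <-; rewrite expn1 addnC.
  apply/eqP; rewrite -(eqn_add2r (p * s j)) -(step j.+1) mulSn {2}IH !expnS.
  apply/eqP; ring.
rewrite -/(s k) -s0; elim: k => [|k IH]; first by rewrite big_ord1 mul1n.
by rewrite big_ord_recr /= mulnDl -IH sS addnC.
Qed.

Lemma pbar3_dvd7 p N k : prime p -> odd p -> coprime N p ->
  (7 %| \sum_(i < k.+1) p ^ i)%N ->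
  (pbar3 (7 * p ^ (2 * k + 1) * N) = 0 %[mod 7])%N.
Proof.
move=> p_prime p_odd coNp d7; apply/eqP; rewrite mod0n -[_ == _]/(7 %| _)%N.
rewrite -mulnA (dvdn_pcharf (pchar_Fp (isT : prime 7))) pbar3_mul7.
rewrite size_sphere3_pow // natrM; move: d7.
by rewrite (dvdn_pcharf (pchar_Fp (isT : prime 7))) => /eqP ->; rewrite mul0r mulr0.
Qed.

Local Close Scope ring_scope.

Theorem theorem4p4 (p N alpha : nat) (p_prime : prime p) (p_ge3 : 3 <= p)
    (N_gt0 : 0 < N) (N_coprime : coprime N p) :
  [/\ p = 1 %[mod 7] ->
        pbar3 (7 * p ^ (14 * alpha + 13) * N) = 0 %[mod 7],
      p %% 7 \in [:: 2; 3; 4; 5; 6] ->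
        pbar3 (7 * p ^ (12 * alpha + 11) * N) = 0 %[mod 7]
    & p = 6 %[mod 7] ->
        pbar3 (7 * p ^ 3 * N) = 0 %[mod 7]].
Proof.
have p_odd : odd p by case: (even_prime p_prime) p_ge3 => [->|].
split=> [p1|p_res|p6].
- rewrite (_ : 14 * alpha + 13 = 2 * (7 * alpha + 6) + 1); last by lia.
  apply: pbar3_dvd7 => //; rewrite /dvdn -modn_summ.
  (* Every power of [p] is 1 modulo 7, and the sum has 7 (alpha + 1) terms. *)
  under eq_bigr do rewrite -modnXm p1 modnXm exp1n.
  rewrite modn_summ sum_nat_const card_ord muln1.
  by rewrite (_ : (7 * alpha + 6).+1 = 7 * alpha.+1) ?modnMr //; lia.
- rewrite (_ : 12 * alpha + 11 = 2 * (6 * alpha + 5) + 1); last by lia.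
  apply: pbar3_dvd7 => //.
  (* As 7 is prime to p - 1, the sum may be multiplied by p - 1; this gives p^(6 (alpha + 1)) - 1,
     divisible by 7 by Fermat. *)
  have co7 : coprime p.-1 7.
    rewrite coprime_sym prime_coprime //; apply/negP => /dvdnP[k ek].
    move: p_res; rewrite -(prednK (prime_gt0 p_prime)) ek -addn1 modnMDl.
    by [].
  have co7p : coprime p 7.
    rewrite coprime_sym prime_coprime // /dvdn; apply/negP => /eqP e.
    by rewrite e in p_res.
  rewrite coprime_sym in co7; rewrite -(Gauss_dvdr _ co7) -predn_exp.
  rewrite (_ : (6 * alpha + 5).+1 = 6 * alpha.+1); last by lia.
  rewrite -subn1 -eqn_mod_dvd ?expn_gt0 ?prime_gt0 //.
  have p6 : p ^ 6 %% 7 = 1.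
    have /allP fermat : all (fun r => r ^ 6 %% 7 == 1) [:: 2; 3; 4; 5; 6] by [].
    by rewrite -modnXm; apply/eqP/fermat.
  by rewrite expnM -modnXm p6 exp1n.
(* The sum of powers is 1 + p. *)
- rewrite (_ : 3 = 2 * 1 + 1) //; apply: pbar3_dvd7 => //.
  by rewrite 2!big_ord_recl big_ord0 /bump /= addn0 expn1 /dvdn -modnDmr p6.
Qed.
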